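(* Let $G$ be a finite digraph, let $\mathcal{M}_V=(V_G,\mathcal{I}_V)$ be a matroid on the node set $V_G$, and let $K$ be a (directed) cycle in $G$, with node set $Z := V_K$ and arc set $A_K$, such that $Z$ is independent with respect to $\mathcal{M}_V$. Let $B$ be a matroid branching in $G$ with respect to $\mathcal{M}_V$ such that $|B \cap A_K| = |Z| - 1$. Put $G' := G/Z$, $\mathcal{M}_V' := \mathcal{M}_V/Z$ and $B' := B \setminus \gamma(Z)$. Then $B'$ is a matroid branching in $G'$ with respect to $\mathcal{M}_V'$. Moreover, if $B'$ has maximum cardinality among all matroid branchings in $G'$ with respect to $\mathcal{M}_V'$, then $B$ has maximum cardinality among all matroid branchings in $G$ with respect to $\mathcal{M}_V$.
   Context: A digraph $G$ has a finite node set $V_G$ and a finite arc set $A_G$; each arc has a tail and a head, and distinct arcs may be parallel (contraction can create parallel arcs). For $X\subseteq V_G$: $\delta^{\rm in}(X)$ (resp. $\delta^{\rm out}(X)$) is the set of arcs entering (resp. leaving) $X$, and $\gamma(X)$ is the set of arcs with both endpoints in $X$. A branching in $G$ is a set $B\subseteq A_G$ such that the underlying undirected graph spanned by $B$ is acyclic and each node of $G$ is entered (covered) by at most one arc of $B$. For $B\subseteq A_G$, $C(B)$ denotes the set of nodes entered by an arc of $B$. Given a matroid $\mathcal{M}_V=(V_G,\mathcal{I}_V)$, a matroid branching in $G$ w.r.t. $\mathcal{M}_V$ is a branching $B$ in $G$ with $C(B)\in\mathcal{I}_V$. Contraction of a digraph: for nonempty $Q\subseteq V_G$, the digraph $G/Q$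 is obtained from $G$ by removing all nodes of $Q$, adding one new (composite) node $\overline{Q}$, removing all arcs of $\gamma(Q)$, changing to $\overline Q$ the heads of all arcs in $\delta^{\rm in}(Q)$ and the tails of all arcs in $\delta^{\rm out}(Q)$, and keeping all other arcs unchanged. Thus the arcs of $G/Q$ are identified with the arcs in $A_G\setminus\gamma(Q)$. Contraction of a matroid (not the usual notion): for a matroid $\mathcal{M}=(E,\mathcal{I})$ and nonempty $Q\subseteq E$, $\mathcal{M}/Q$ has ground set $E' := (E\setminus Q)\cup\{\overline Q\}$, where $\overline Q$ is a new element. A set $X\subseteq E'\setminus\{\overline Q\}$ is independent in $\mathcal{M}/Q$ iff there is $q\in Q$ with $X\cup (Q\setminus\{q\})\in\mathcal{I}$; a set $X\subseteq E'$ with $\overline Q\in X$ is independent in $\mathcal{M}/Q$ iff $(X\setminus\{\overline Q\})\cup Q\in\mathcal{I}$. *)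

(* Defs.v *)
From mathcomp Require Import all_boot.

Set Implicit Arguments.
Unset Strict Implicit.
Unset Printing Implicit Defensive.

Record matroid (E : finType) := Matroid {
  indep : {set {set E}};
  indep0 : set0 \in indep;
  indepS : forall X Y : {set E}, X \subset Y -> Y \in indep -> X \in indep;
  indep_aug : forall X Y : {set E},
    X \in indep -> Y \in indep -> #|X| < #|Y| ->
    exists2 e, e \in Y :\: X & e |: X \in indep
}.

(* [(T \ Q) + {Qbar}]: [None] is the composite element [Qbar]. *)
Definition contr (T : finType) (Q : {set T}) : finType :=
  option {x : T | x \notin Q}.

(* The part [X \ {Qbar}] of [X], seen as a subset of [T]. *)
Definition old_part (T : finType) (Q : {set T}) (X : {set contr Q}) : {set T} :=
  [set val u | u in [set u | Some u \in X]].

(* Not the usual matroid contraction: [Qbar] replaces [Q], and a set avoiding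
   [Qbar] need only be independent together with all but one element of [Q]. *)
Definition contr_indep (E : finType) (M : matroid E) (Q : {set E}) :
    {set {set contr Q}} :=
  [set X : {set contr Q} | if None \in X then old_part X :|: Q \in indep M
           else [exists q in Q, old_part X :|: (Q :\ q) \in indep M]].

Section ContractMatroid.
Variables (E : finType) (M : matroid E) (Q : {set E}).

Lemma old_partP (X : {set contr Q}) x :
  reflect (exists2 u : {x : E | x \notin Q}, Some u \in X & x = val u)
          (x \in old_part X).
Proof.
apply: (iffP imsetP) => [[u]|[u uX ->]]; first by rewrite inE; exists u.
by exists u; rewrite ?inE.
Qed.

Lemma old_partNQ (X : {set contr Q}) x : x \in old_part X -> x \notin Q.
Proof. by case/old_partP=> u _ ->; apply: (valP u). Qed.

Lemma mem_old_part (X : {set contr Q}) u :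
  (val u \in old_part X) = (Some u \in X).
Proof.
by apply/old_partP/idP => [[v vX /val_inj->]|uX] //; exists u.
Qed.

Lemma old_partS (X Y : {set contr Q}) :
  X \subset Y -> old_part X \subset old_part Y.
Proof.
move=> /subsetP sXY; apply/subsetP=> x /old_partP[u /sXY uY ->].
by rewrite mem_old_part.
Qed.

Lemma old_partU1 (X : {set contr Q}) u :
  old_part (Some u |: X) = val u |: old_part X.
Proof.
apply/setP=> x; rewrite !inE; apply/old_partP/orP.
- case=> v; rewrite !inE => /orP[/eqP[->] ->|vX ->]; first by left.
  by right; rewrite mem_old_part.
- case=> [/eqP->|/old_partP[v vX ->]]; first by exists u; rewrite ?setU11.
  by exists v; rewrite // setU1r.
Qed.

Lemma old_partUN (X : {set contr Q}) : old_part (None |: X) = old_part X.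
Proof.
by apply/setP=> x; apply/old_partP/old_partP=> -[u];
  rewrite ?inE /= => uX ->; exists u; rewrite ?inE.
Qed.

Lemma card_old_part (X : {set contr Q}) : #|X| = (None \in X) + #|old_part X|.
Proof.
rewrite (cardsD1 None X); congr (_ + _).
rewrite card_imset; last exact: val_inj.
have Sinj : injective (@Some {x : E | x \notin Q}) by move=> u v [].
rewrite -(card_imset _ Sinj).
apply: eq_card => -[u|]; rewrite !inE /=.
- by rewrite mem_imset ?inE.
- by symmetry; apply/imsetP=> -[].
Qed.

Lemma card_old_partU (X : {set contr Q}) (S : {set E}) :
  S \subset Q -> #|old_part X :|: S| = #|old_part X| + #|S|.
Proof.
move=> /subsetP sSQ; rewrite cardsU (_ : _ :&: _ = set0) ?cards0 ?subn0 //.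
apply/setP=> x; rewrite !inE; apply/andP=> -[/old_partNQ xNQ /sSQ].
by apply/negP.
Qed.

Lemma contr_indepN (X : {set contr Q}) : None \in X ->
  (X \in contr_indep M Q) = (old_part X :|: Q \in indep M).
Proof. by rewrite inE => ->. Qed.

Lemma contr_indepP (X : {set contr Q}) : None \notin X ->
  reflect (exists2 q, q \in Q & old_part X :|: (Q :\ q) \in indep M)
          (X \in contr_indep M Q).
Proof. by rewrite inE => /negbTE ->; apply: exists_inP. Qed.

Hypotheses (Q_neq0 : Q != set0) (Q_indep : Q \in indep M).

Lemma contr_indep0 : set0 \in contr_indep M Q.
Proof.
case/set0Pn: Q_neq0 => q qQ; apply/contr_indepP; rewrite ?inE //.
exists q => //; apply: indepS Q_indep.
rewrite subUset subD1set andbT; apply/subsetP=> x /old_partP[u].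
by rewrite inE.
Qed.

Lemma contr_indepS (X Y : {set contr Q}) :
  X \subset Y -> Y \in contr_indep M Q -> X \in contr_indep M Q.
Proof.
move=> sXY; have sp := old_partS sXY.
have [NX|NX] := boolP (None \in X).
  rewrite !contr_indepN ?(subsetP sXY) //; apply: indepS; exact: setSU.
have [NY|NY] := boolP (None \in Y).
  rewrite contr_indepN // => iY; apply/contr_indepP => //.
  case/set0Pn: Q_neq0 => q qQ; exists q => //; apply: indepS iY.
  by apply: setUSS; rewrite ?subD1set.
case/contr_indepP=> // q qQ iY; apply/contr_indepP => //; exists q => //.
by apply: indepS iY; apply: setSU.
Qed.

Lemma contr_indep_aug (X Y : {set contr Q}) :
  X \in contr_indep M Q -> Y \in contr_indep M Q -> #|X| < #|Y| ->
  exists2 e, e \in Y :\: X & e |: X \in contr_indep M Q.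
Proof.
move=> iX iY; rewrite (card_old_part X) (card_old_part Y) => ltXY.
have QD q : q \in Q -> #|Q| = #|Q :\ q|.+1 by move=> qQ; rewrite (cardsD1 q) qQ.
have addN e : e \in old_part Y -> e \notin old_part X -> None \in X ->
    e |: (old_part X :|: Q) \in indep M ->
    exists2 e, e \in Y :\: X & e |: X \in contr_indep M Q.
  case/old_partP=> u uY ->; rewrite mem_old_part => uX NX i.
  exists (Some u); first by rewrite inE uX.
  by rewrite contr_indepN ?setU1r // old_partU1 -setUA.
have addS e q : e \in old_part Y -> e \notin old_part X -> None \notin X ->
    q \in Q -> e |: (old_part X :|: (Q :\ q)) \in indep M ->
    exists2 e, e \in Y :\: X & e |: X \in contr_indep M Q.
  case/old_partP=> u uY ->; rewrite mem_old_part => uX NX qQ i.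
  exists (Some u); first by rewrite inE uX.
  apply/contr_indepP; first by rewrite !inE.
  by exists q => //; rewrite old_partU1 -setUA.
have [NX|NX] := boolP (None \in X); rewrite ?NX ?(negbTE NX) in ltXY.
  have i1 := iX; rewrite contr_indepN // in i1.
  have [NY|NY] := boolP (None \in Y); rewrite ?NY ?(negbTE NY) in ltXY.
    have i2 := iY; rewrite contr_indepN // in i2.
    have [|e] := indep_aug i1 i2; first by rewrite !card_old_partU // ltn_add2r.
    rewrite !inE negb_or => /andP[/andP[eX eQ]].
    by rewrite (negbTE eQ) orbF => eY; apply: addN.
  have /contr_indepP[//|q qQ i2] := iY.
  have [|e] := indep_aug i1 i2.
    rewrite !card_old_partU ?subD1set // (QD q) // -addSnnS ltn_add2r.
    by rewrite -add1n.
  rewrite !inE negb_or => /andP[/andP[eX eQ]].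
  by rewrite (negbTE eQ) andbF orbF => eY; apply: addN.
have /contr_indepP[//|q qQ i1] := iX.
have addQ q' : q' \in Q -> q' |: (old_part X :|: Q :\ q') \in indep M ->
    old_part X :|: Q \in indep M.
  by move=> q'Q; rewrite setUCA setD1K.
have [NY|NY] := boolP (None \in Y); rewrite ?NY ?(negbTE NY) in ltXY.
  have i2 := iY; rewrite contr_indepN // in i2.
  have [|e] := indep_aug i1 i2.
    rewrite !card_old_partU ?subD1set // (QD q) // -addSnnS ltn_add2r.
    by rewrite -add1n.
  rewrite !inE negb_or negb_and negbK => /andP[/andP[eX eQ] eYQ] i3.
  have [eQ'|eQ'] := boolP (e \in Q).
    move: eQ; rewrite eQ' orbF => /eqP eq; rewrite eq in i3.
    exists None; first by rewrite inE NX.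
    rewrite contr_indepN ?setU11 // old_partUN; exact: addQ i3.
  by move: eYQ; rewrite (negbTE eQ') orbF => eY; apply: addS i3.
have /contr_indepP[//|q' q'Q i2] := iY.
have [|e] := indep_aug i1 i2.
  rewrite !card_old_partU ?subD1set //.
  by move: (QD q qQ); rewrite (QD q' q'Q) => -[->]; rewrite ltn_add2r.
rewrite !inE negb_or negb_and negbK => /andP[/andP[eX eQ] eYQ] i3.
have [eQ'|eQ'] := boolP (e \in Q); last first.
  by move: eYQ; rewrite (negbTE eQ') andbF orbF => eY; apply: addS i3.
move: eQ; rewrite eQ' orbF => /eqP eq; rewrite eq in i3.
have i4 : old_part X :|: Q :\ q' \in indep M.
  by apply: indepS (addQ _ qQ i3); apply: setUS; apply: subD1set.
have [|f] := indep_aug i4 i2; first by rewrite !card_old_partU ?subD1set // ltn_add2r.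
rewrite !inE negb_or => /andP[/andP[fX fQ]].
by rewrite (negbTE fQ) orbF => fY; apply: addS.
Qed.

Definition contr_matroid : matroid (contr Q) :=
  Matroid contr_indep0 contr_indepS contr_indep_aug.

End ContractMatroid.

(* Parallel arcs and loops are allowed. *)
Record digraph := Digraph {
  node : finType;
  darc : finType;
  dtail : darc -> node;
  dhead : darc -> node
}.

Definition gamma (G : digraph) (X : {set node G}) : {set darc G} :=
  [set a | (dtail a \in X) && (dhead a \in X)].

(* [insub x] is [None], the composite node, exactly when [x] belongs to [Q]. *)
Definition contr_digraph (G : digraph) (Q : {set node G}) : digraph :=
  @Digraph (contr Q) {a : darc G | a \notin gamma Q}
    (fun a => insub (dtail (val a))) (fun a => insub (dhead (val a))).

(* [B \ gamma(Q)] as a set of arcs of [G/Q]. *)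
Definition contr_arcs (G : digraph) (Q : {set node G}) (B : {set darc G}) :
    {set darc (contr_digraph Q)} :=
  [set a : {a : darc G | a \notin gamma Q} | val a \in B].

(* An arc traversed forwards ([true]) or backwards ([false]). *)
Definition step_from (G : digraph) (d : darc G * bool) : node G :=
  if d.2 then dtail d.1 else dhead d.1.
Definition step_to (G : digraph) (d : darc G * bool) : node G :=
  if d.2 then dhead d.1 else dtail d.1.

(* Distinctness of arcs only matters for length 2: an arc traversed back and
   forth is not a cycle, but two parallel or antiparallel arcs form one. *)
Definition undirected_cycle (G : digraph) (s : seq (darc G * bool)) : bool :=
  [&& s != [::], cycle (fun d e => step_to d == step_from e) s,
      uniq [seq step_from d | d <- s] & uniq [seq d.1 | d <- s]].

Definition acyclic (G : digraph) (B : {set darc G}) : Prop :=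
  forall s : seq (darc G * bool),
    undirected_cycle s -> ~ {subset [seq d.1 | d <- s] <= B}.

Definition branching (G : digraph) (B : {set darc G}) : Prop :=
  acyclic B /\ forall v : node G, #|[set a in B | dhead a == v]| <= 1.

(* The set [C(B)]. *)
Definition covered (G : digraph) (B : {set darc G}) : {set node G} :=
  [set dhead a | a in B].

Definition matroid_branching (G : digraph) (M : matroid (node G))
    (B : {set darc G}) : Prop :=
  branching B /\ covered B \in indep M.

Definition maximum_matroid_branching (G : digraph) (M : matroid (node G))
    (B : {set darc G}) : Prop :=
  matroid_branching M B /\
  forall B1 : {set darc G}, matroid_branching M B1 -> #|B1| <= #|B|.

(* A directed cycle is given by the sequence of its arcs. *)
Definition dicycle (G : digraph) (K : seq (darc G)) : bool :=
  [&& K != [::], cycle (fun a b => dhead a == dtail b) K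
    & uniq [seq dtail a | a <- K]].

Definition cycle_nodes (G : digraph) (K : seq (darc G)) : {set node G} :=
  [set dtail a | a in K].

Definition cycle_arcs (G : digraph) (K : seq (darc G)) : {set darc G} :=
  [set a in K].

Lemma cycle_nodes_neq0 (G : digraph) (K : seq (darc G)) :
  dicycle K -> cycle_nodes K != set0.
Proof.
case: K => // a K _; apply/set0Pn; exists (dtail a).
by apply: imset_f; apply: mem_head.
Qed.

(* Main.v *)
(** A node set [I] is the covered set of some branching iff every node is
    reachable from the complement of [I], so a maximum matroid branching is
    the same thing as a maximum independent set with this property.  Given
    such a set [I] in [G], one finds such a set of size at least
    [|I| - |Z| + 1] in [G/Z]: if [Z] is contained in [I], replace [Z] by the
    composite node; otherwise fix [q] in [Z \ I], extend [Z \ q] by elements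
    of [I] to an independent set of size at least [|I|], and drop [Z].  As
    [|B| >= |B'| + |Z| - 1], maximality of [B'] implies that of [B].

    That [B'] is a branching is seen from a height function: a set of arcs
    with indegrees at most one is acyclic iff some function on the nodes
    strictly increases along its arcs.  Exactly one node [r] of [Z] is not
    entered by an arc of [B] on the cycle; it has the least height in [Z] and
    is the only node of [Z] that [B] may enter from outside, so giving the
    composite node the height of [r] yields a height function on [G/Z]. *)

Require Import Defs.
From mathcomp Require Import all_boot.

Set Implicit Arguments.
Unset Strict Implicit.
Unset Printing Implicit Defensive.

(** * Extension of independent sets *)

Lemma indep_extend (E : finType) (M : matroid E) (X Y : {set E}) :
  X \in indep M -> Y \in indep M ->
  exists W, [/\ W \in indep M, X \subset W, W \subset X :|: Y & #|Y| <= #|W|].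
Proof.
move=> iX iY; move: {2}(#|Y| - #|X|) (leqnn (#|Y| - #|X|)) => n.
elim: n X iX => [|n IHn] X iX.
  by rewrite leqn0 subn_eq0 => leYX; exists X; rewrite subsetUl.
have [leYX _|ltXY leYXn] := leqP #|Y| #|X|; first by exists X; rewrite subsetUl.
have [e /setDP[eY eX] ieX] := indep_aug iX iY ltXY.
have [|W [iW sXW sWXY leYW]] := IHn _ ieX.
  by rewrite cardsU1 eX add1n subnS -ltnS (ltn_predK (m := 0)) ?subn_gt0.
exists W; split=> //; first exact: subset_trans (subsetUr _ _) sXW.
by apply: subset_trans sWXY _; rewrite -setUA subUset sub1set inE eY orbT /=.
Qed.

(** * Branchings and height functions *)

Definition arc_increasing (G : digraph) (B : {set darc G}) (h : node G -> nat) :=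
  {in B, forall a, h (dtail a) < h (dhead a)}.

Lemma indegree_inj (G : digraph) (B : {set darc G}) :
  (forall v : node G, #|[set a in B | dhead a == v]| <= 1) <->
  {in B &, injective (@dhead G)}.
Proof.
split=> [deg a b aB bB eq_ab|injB v].
  by apply: (card_le1_eqP (deg (dhead b))); rewrite inE ?aB ?bB ?eq_ab eqxx.
apply/card_le1_eqP=> a b; rewrite !inE => /andP[aB /eqP<-] /andP[bB /eqP eq_ab].
exact: injB.
Qed.

Lemma card_covered (G : digraph) (B : {set darc G}) :
  branching B -> #|covered B| = #|B|.
Proof. by case=> _ /indegree_inj injB; apply: card_in_imset. Qed.

Lemma uniq_map_inj (T1 T2 : eqType) (f : T1 -> T2) (s : seq T1) :
  uniq [seq f x | x <- s] -> {in s &, injective f}.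
Proof.
elim: s => // x s IHs /= /andP[fxNs uniq_s] y z.
rewrite !inE => /predU1P[->|ys] /predU1P[->|zs] // eq_f.
- by rewrite eq_f map_f in fxNs.
- by rewrite -eq_f map_f in fxNs.
- exact: IHs eq_f.
Qed.

Lemma arc_increasing_branching (G : digraph) (B : {set darc G}) h :
  {in B &, injective (@dhead G)} -> arc_increasing B h -> branching B.
Proof.
move=> injB incB; split; last exact/indegree_inj.
move=> s /and4P[s_neq0 cyc_s _ uniq_s] sB.
have inB d : d \in s -> d.1 \in B by move=> ds; apply/sB/map_f.
(* The two arcs of [s] at a highest node of [s] both enter it, so they
   coincide. *)
have [d ds max_d] : exists2 d, d \in s &
    forall e, e \in s -> h (step_from e) <= h (step_from d).
  case: s s_neq0 {cyc_s uniq_s sB inB} => // d0 s _.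
  case: (@arg_maxnP _ d0 (mem (d0 :: s)) (fun d => h (step_from d))).
    exact: mem_head.
  by move=> d ds max_d; exists d.
have pS : prev s d \in s by rewrite mem_prev.
have /eqP to_p := prev_cycle cyc_s ds; have /eqP to_d := next_cycle cyc_s ds.
have le_p := max_d _ pS.
have le_d : h (step_to d) <= h (step_from d).
  by rewrite to_d max_d ?mem_next.
have dF : d.2 = false.
  move: le_d; rewrite /step_to /step_from; case: d.2 => //.
  by rewrite leqNgt incB ?inB.
have pT : (prev s d).2.
  move: le_p; rewrite -to_p /step_to /step_from; case: (prev s d).2 => //.
  by rewrite leqNgt incB ?inB.
have eq_pd : prev s d = d.
  apply: (uniq_map_inj uniq_s) => //; apply: injB; rewrite ?inB //.
  by move: to_p; rewrite /step_to /step_from dF pT.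
by rewrite eq_pd dF in pT.
Qed.

(** The height of [v] counts the arcs of [B] on directed paths of [B] ending at [v]. An arc is
    counted at its head, but at its tail only if it lies on a directed cycle. *)
Lemma branching_arc_increasing (G : digraph) (B : {set darc G}) :
  branching B -> exists h, arc_increasing B h.
Proof.
case=> acycB /indegree_inj injB.
pose e (a b : darc G) := [&& a \in B, b \in B & dtail a == dhead b].
pose anc v := [set b | [exists c in B, (dhead c == v) && connect e c b]].
exists (fun v => #|anc v|) => a aB; apply/proper_card/properP; split.
  apply/subsetP=> b; rewrite !inE => /exists_inP[c cB /andP[/eqP hc ecb]].
  apply/exists_inP; exists a; rewrite // eqxx /=.
  by apply: connect_trans ecb; apply: connect1; rewrite /e aB cB hc eqxx.
exists a; rewrite inE.
  by apply/exists_inP; exists a; rewrite ?eqxx ?connect0.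
apply/exists_inP=> -[c cB /andP[/eqP hc /connectP[p0 ep0 a_last]]].
case/shortenP: ep0 a_last => p ep uniq_p _ a_last.
have cyc_p : cycle e (c :: p).
  by rewrite /= rcons_path ep -a_last /e aB cB hc eqxx.
have pB : {subset c :: p <= B}.
  by move=> x xp; case/and3P: (next_cycle cyc_p xp).
(* [e] leads from an arc to one preceding it, so every arc is traversed backwards. *)
pose s := [seq (x, false) | x <- c :: p].
have map_s : [seq d.1 | d <- s] = c :: p by rewrite -map_comp map_id.
apply: (acycB s); last by rewrite map_s.
apply/and4P; split=> //; rewrite ?map_s //.
  have -> : s = (c, false) :: [seq (x, false) | x <- p] by [].
  rewrite /cycle -(map_rcons _ p c) path_map.
  by apply: sub_path cyc_p => x y /and3P[].
rewrite -map_comp map_inj_in_uniq // => x y /pB xB /pB; exact: injB.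
Qed.

(** * Covered sets as a reachability condition *)

Fixpoint reach (G : digraph) (S : {set node G}) n : {set node G} :=
  if n is m.+1 then
    reach S m :|: [set dhead a | a in [set a | dtail a \in reach S m]]
  else S.

Definition coverable (G : digraph) (I : {set node G}) :=
  forall v, exists n, v \in reach (~: I) n.

Lemma reach_step (G : digraph) (S : {set node G}) n a :
  dtail a \in reach S n -> dhead a \in reach S n.+1.
Proof. by move=> ta; rewrite inE imset_f ?inE ?orbT. Qed.

Lemma branching_coverable (G : digraph) (B : {set darc G}) :
  branching B -> coverable (covered B).
Proof.
move=> /branching_arc_increasing[h incB] v.
have [k] := ubnP (h v); elim: k v => // k IHk v ltvk.
have [/imsetP[a aB eq_v]|vB] := boolP (v \in covered B); last first.
  by exists 0; rewrite inE.
have [|n ta] := IHk (dtail a).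
  by rewrite -ltnS; apply: leq_ltn_trans ltvk; rewrite eq_v incB.
by exists n.+1; rewrite eq_v reach_step.
Qed.

(** Breadth-first search: each node of [I] selects an entering arc whose tail is closer to the
    complement of [I], and this distance [d] serves as the height. *)
Lemma coverable_branching (G : digraph) (I : {set node G}) :
  coverable I -> exists2 B : {set darc G}, branching B & covered B = I.
Proof.
move=> covI; pose d v := ex_minn (covI v).
have arcP v : v \in I -> exists2 a, dhead a = v & d (dtail a) < d v.
  move=> vI; rewrite {2}/d; case: ex_minnP => -[|n]; first by rewrite !inE vI.
  rewrite inE => /orP[vn /(_ n vn)|]; first by rewrite ltnn.
  case/imsetP=> a; rewrite inE => ta -> _; exists a => //.
  by rewrite /d; case: ex_minnP => m _ /(_ n ta).
pose arc v := [pick a | (dhead a == v) && (d (dtail a) < d v)].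
pose B := [set a | (dhead a \in I) && (arc (dhead a) == Some a)].
have BP a : a \in B -> [/\ dhead a \in I, arc (dhead a) = Some a
    & d (dtail a) < d (dhead a)].
  rewrite inE => /andP[aI /eqP arc_a]; split=> //.
  move: arc_a; rewrite /arc; case: pickP => // b /andP[_ lt_b] [eq_b].
  by rewrite eq_b in lt_b.
exists B.
  apply: (@arc_increasing_branching _ _ d) => [a b|a aB];
    last by case: (BP a aB).
  by move=> /BP[_ arc_a _] /BP[_ + _] eq_ab; rewrite -eq_ab arc_a => -[].
apply/setP=> v; apply/imsetP/idP=> [[a /BP[aI _ _] ->] //|vI].
have [a] : exists a, arc v = Some a.
  rewrite /arc; case: pickP => [a _|noa]; first by exists a.
  by have [a /eqP av lt_a] := arcP v vI; move: (noa a); rewrite av lt_a.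
move=> arc_v; have av : dhead a = v.
  by move: arc_v; rewrite /arc; case: pickP => // b /andP[/eqP<- _] [<-].
by exists a; rewrite // inE av vI arc_v eqxx.
Qed.

(** * Transfer of coverable independent sets to the contraction *)

Definition contr_set (T : finType) (Q : {set T}) (b : bool) (W : {set T}) :
    {set contr Q} :=
  [set u | if u is Some x then val x \in W else b].

Section ContrSet.
Variables (T : finType) (Q : {set T}).

Lemma contr_set_None b (W : {set T}) : (None \in contr_set Q b W) = b.
Proof. by rewrite inE. Qed.

Lemma old_part_contr_set b (W : {set T}) : old_part (contr_set Q b W) = W :\: Q.
Proof.
apply/setP=> x; rewrite inE; apply/old_partP/andP=> [[u]|[xQ xW]].
  by rewrite inE => uW ->; rewrite (valP u).
by exists (Sub x xQ); rewrite ?inE.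
Qed.

Lemma mem_contr_set b (W : {set T}) x :
  insub x \in contr_set Q b W = if x \in Q then b else x \in W.
Proof. by rewrite inE; case: insubP => [u /negbTE-> ->|/negbNE->]. Qed.

End ContrSet.

(** Walks project to the contraction: an arc inside [Q] becomes a stay at the composite node, any
    other arc survives. *)
Lemma coverable_contr (G : digraph) (Q I : {set node G}) (J : {set contr Q}) :
  Q != set0 -> coverable I ->
  (forall v, insub v \in J -> v \in I) -> @coverable (contr_digraph Q) J.
Proof.
move=> /set0Pn[q qQ] covI sJI u.
have [v ->] : exists v, u = insub v.
  case: u => [u|]; first by exists (val u); rewrite valK.
  by exists q; rewrite insubF ?qQ.
have [n vn] := covI v; exists n; elim: n v vn => [|n IHn] v /=.
  by rewrite !in_setC; apply: contra; apply: sJI.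
rewrite in_setU => /orP[/IHn vJ|/imsetP[a]]; first by rewrite inE vJ.
rewrite inE => /IHn ta ->; have [ain|aNin] := boolP (a \in gamma Q).
  move: ain ta; rewrite inE => /andP[taQ haQ].
  by rewrite !insubF ?taQ ?haQ // inE => ->.
exact: (@reach_step (contr_digraph Q) _ _ (Sub a aNin)).
Qed.

Lemma coverable_indep_contr (G : digraph) (M : matroid (node G))
    (Q I : {set node G}) :
  Q != set0 -> Q \in indep M -> I \in indep M -> coverable I ->
  exists J : {set contr Q}, [/\ J \in contr_indep M Q,
    @coverable (contr_digraph Q) J & #|I| <= #|J| + (#|Q| - 1)].
Proof.
move=> Q_neq0 iQ iI covI.
have [sQI|/subsetPn[q qQ qI]] := boolP (Q \subset I).
  exists (contr_set Q true I); split.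
  - rewrite contr_indepN ?contr_set_None // old_part_contr_set.
    by rewrite setUC -{1}(setIidPr sQI) setID.
  - apply: coverable_contr covI _ => // v; rewrite mem_contr_set.
    by case: ifP => // vQ _; apply: (subsetP sQI).
  - rewrite card_old_part contr_set_None old_part_contr_set cardsDS //.
    by rewrite addnAC !subnKC ?subset_leq_card ?card_gt0.
have [|W [iW sQW sWQI leIW]] := indep_extend (X := Q :\ q) _ iI.
  by apply: indepS iQ; apply: subD1set.
(* Since [W] misses [q], removing [Q] from [W] costs at most [#|Q| - 1] elements. *)
have qW : q \notin W.
  by apply/negP=> /(subsetP sWQI); rewrite !inE eqxx (negbTE qI).
exists (contr_set Q false W); split.
- apply/contr_indepP; rewrite ?contr_set_None // old_part_contr_set.
  by exists q => //; apply: indepS iW; rewrite subUset subsetDl.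
- apply: coverable_contr covI _ => // v; rewrite mem_contr_set.
  case: ifP => // vQ /(subsetP sWQI).
  by rewrite !inE vQ andbF.
- rewrite card_old_part contr_set_None old_part_contr_set.
  have leWQ : #|W :&: Q| <= #|Q| - 1.
    rewrite (cardsD1 q Q) qQ add1n subn1; apply/subset_leq_card/subsetP=> x.
    rewrite !inE => /andP[xW ->]; rewrite andbT.
    by apply: contraNneq qW => <-.
  by rewrite add0n (leq_trans leIW) // -(cardsID Q W) addnC leq_add2l.
Qed.

(** * The contracted branching *)

(** Arcs of [B] inside [Q] have distinct heads, none of them a lowest node [r]. By counting, the
    heads fill [Q :\ r], so an arc from outside can only enter [r]. *)
Lemma spanned_root (G : digraph) (B : {set darc G}) (Q : {set node G}) h :
  Q != set0 -> {in B &, injective (@dhead G)} -> arc_increasing B h ->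
  #|Q| - 1 <= #|B :&: gamma Q| ->
  exists2 r, r \in Q & [/\ {in Q, forall v, h r <= h v},
    Q :\ r \subset covered B & forall a,
      a \in B -> a \notin gamma Q -> dhead a \in Q -> dhead a = r].
Proof.
move=> /set0Pn[q qQ] injB incB leQ.
have [r rQ min_r] : exists2 r, r \in Q & {in Q, forall v, h r <= h v}.
  by case: (arg_minnP h qQ) => r; exists r.
exists r => //.
have sDQ : covered (B :&: gamma Q) \subset Q :\ r.
  apply/subsetP=> _ /imsetP[a aBQ ->].
  move: aBQ; rewrite !inE => /and3P[aB /min_r le_r ->].
  by rewrite andbT; apply: contraTneq le_r => <-; rewrite -ltnNge incB.
have /eqP DQ : covered (B :&: gamma Q) == Q :\ r.
  rewrite eqEcard sDQ card_in_imset /=; last first.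
    by move=> a b /setIP[aB _] /setIP[bB _]; apply: injB.
  by rewrite (leq_trans _ leQ) // (cardsD1 r Q) rQ add1n subn1.
split=> //; first by rewrite -DQ imsetS ?subsetIl.
move=> a aB aNQ haQ; apply: contraNeq aNQ => ar.
have : dhead a \in covered (B :&: gamma Q) by rewrite DQ !inE ar.
by case/imsetP=> b /setIP[bB bQ] /(injB _ _ aB bB)->.
Qed.

Lemma contr_matroid_branching (G : digraph) (M : matroid (node G))
    (Q : {set node G}) (B : {set darc G}) (Q_neq0 : Q != set0)
    (iQ : Q \in indep M) :
  matroid_branching M B -> #|Q| - 1 <= #|B :&: gamma Q| ->
  @matroid_branching (contr_digraph Q) (contr_matroid Q_neq0 iQ)
    (contr_arcs Q B).
Proof.
move=> [brB iB] leQ; have [h incB] := branching_arc_increasing brB.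
have injB : {in B &, injective (@dhead G)} by apply/indegree_inj; case: brB.
have [r rQ [min_r sQB head_r]] := spanned_root Q_neq0 injB incB leQ.
split.
  pose h' (u : contr Q) := if u is Some x then h (val x) else h r.
  apply: (@arc_increasing_branching (contr_digraph Q) _ h').
    move=> a b; rewrite !inE => aB bB /= eq_ab; apply/val_inj/injB => //.
    move: eq_ab; case: insubP => [u _ <-|/negbNE aQ].
      by case: insubP => // v _ <- [->].
    case: insubP => // /negbNE bQ _.
    by rewrite (head_r _ aB (valP a) aQ) (head_r _ bB (valP b) bQ).
  move=> a; rewrite inE /h' /= => aB; have := incB _ aB.
  have := valP a; rewrite inE.
  case: insubP => [u _ <-|/negbNE taQ]; case: insubP => [v _ <-|/negbNE haQ] //.
  - by move=> aNQ; rewrite -(head_r (val a)) ?(valP a).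
  - by move=> _; apply: leq_ltn_trans; apply: min_r.
  - by rewrite taQ haQ.
have sJB : old_part (covered (contr_arcs Q B) : {set contr Q}) \subset covered B.
  apply/subsetP=> x /old_partP[u /imsetP[a]]; rewrite inE => aB /= + ->.
  by case: insubP => // v _ eq_v [->]; rewrite eq_v imset_f.
(* If the composite node is covered, the covering arc enters [r] in [G], so all of [Q] is covered by
   [B]; otherwise [r] is the element that may be left out. *)
have [NJ|NJ] := boolP (None \in (covered (contr_arcs Q B) : {set contr Q})).
  rewrite contr_indepN //; apply: indepS iB; rewrite subUset sJB /=.
  rewrite -(setD1K rQ) subUset sQB andbT sub1set.
  case/imsetP: NJ => a; rewrite inE => aB /=.
  case: insubP => // /negbNE haQ _.
  by rewrite -(head_r (val a)) ?(valP a) ?imset_f.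
apply/contr_indepP => //; exists r => //.
by apply: indepS iB; rewrite subUset sJB.
Qed.

Lemma card_contr_arcs (G : digraph) (Q : {set node G}) (B : {set darc G}) :
  #|contr_arcs Q B| + #|B :&: gamma Q| = #|B|.
Proof.
rewrite -(cardsID (gamma Q) B) addnC; congr (_ + _).
rewrite -(card_imset _ val_inj); apply: eq_card => a; rewrite inE.
apply/imsetP/andP=> [[b]|[aNQ aB]].
  by rewrite inE => bB ->; rewrite (valP b).
by exists (Sub a aNQ); rewrite ?inE.
Qed.

Lemma cycle_arcs_sub_gamma (G : digraph) (K : seq (darc G)) :
  dicycle K -> cycle_arcs K \subset gamma (cycle_nodes K).
Proof.
case/and3P=> _ cycK _; apply/subsetP=> a; rewrite !inE => aK.
rewrite imset_f //= (eqP (next_cycle cycK aK)) imset_f //.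
by rewrite mem_next.
Qed.

Theorem theorem1 (G : digraph) (M : matroid (node G)) (K : seq (darc G))
    (hK : dicycle K) (hZ : cycle_nodes K \in indep M)
    (B : {set darc G}) (hB : matroid_branching M B)
    (hBK : #|B :&: cycle_arcs K| = #|cycle_nodes K| - 1) :
  let Z := cycle_nodes K in
  let G' := contr_digraph Z in
  let M' : matroid (node G') := contr_matroid (cycle_nodes_neq0 hK) hZ in
  let B' : {set darc G'} := contr_arcs Z B in
  matroid_branching M' B' /\
  (maximum_matroid_branching M' B' -> maximum_matroid_branching M B).
Proof.
move=> Z G' M' B'; have Z_neq0 := cycle_nodes_neq0 hK.
have leZ : #|Z| - 1 <= #|B :&: gamma Z|.
  by rewrite -hBK subset_leq_card // setIS // cycle_arcs_sub_gamma.
split=> [|[_ maxB']]; first exact: contr_matroid_branching.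
split=> // B1 [brB1 iB1].
have [J [iJ covJ leJ]] :=
  coverable_indep_contr Z_neq0 hZ iB1 (branching_coverable brB1).
have [B2 brB2 covB2] := coverable_branching covJ.
have leB2 : #|J| <= #|B'|.
  have := card_covered brB2; rewrite covB2 => cardJ.
  by rewrite cardJ; apply: maxB'; split; rewrite ?covB2.
(* [#|B1| <= #|J| + (#|Z| - 1) <= #|B'| + #|B :&: gamma Z| = #|B|]. *)
rewrite -(card_covered brB1) (leq_trans leJ) // -(card_contr_arcs Z B).
exact: leq_add.
Qed.
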